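(* Let $F^*$ be a contravariant functor on topological spaces and continuous maps, and let $\theta$ be a cohomology operation on $F^*$. For a continuous map $f:X\to Y$ with a continuous section $s:Y\to X$ (i.e. $f\circ s=\mathrm{id}_Y$), define $$\theta_f:=s^*\circ\theta_X:F^*(X)\xrightarrow{\theta_X}F^*(X)\xrightarrow{s^*}F^*(Y).$$ Then this assignment is a generalized cohomology operation. That is, for every fiber square with $f:X\to Y$, $g:Y'\to Y$, $X'=X\times_YY'$, $g':X'\to X$, $f':X'\to Y'$, where $f'$ is equipped with the section $s':Y'\to X'$ induced by $s$ and $\theta_{f'}:=s'^*\circ\theta_{X'}$, one has $$\theta_{f'}\circ g'^*=g^*\circ\theta_f:F^*(X)\to F^*(Y').$$
   Context: A cohomology operation on a contravariant functor $F^*$ is a natural self-transformation of $F^*$ (as a set-valued functor): a family of maps $\theta_X:F^*(X)\to F^*(X)$, one for each $X$, with $f^*\circ\theta_Y=\theta_X\circ f^*$ for every $f:X\to Y$. A generalized cohomology operation is an assignment $f\mapsto\theta_f$, $\theta_f:F^*(X)\to F^*(Y)$ for $f:X\to Y$, such that $\theta_{f'}\circ g'^*=g^*\circ\theta_f$ for every fiber square $f\circ g'=g\circ f'$ with $g:Y'\to Y$, $g':X'\to X$, $f':X'\to Y'$. Here it is considered for maps equipped with a section. The section $s'$ of $f'$ induced by $s$ is the unique map $s':Y'\to X'$ with $f'\circ s'=\mathrm{id}_{Y'}$ and $g'\circ s'=s\circ g$. *)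

(* Defs.v *)
From HB Require Import structures.
From mathcomp Require Import all_boot.
From mathcomp Require Import all_classical topology.

Set Implicit Arguments.
Unset Strict Implicit.
Unset Printing Implicit Defensive.

Local Open Scope classical_set_scope.

(* Set-valued contravariant functors on topological spaces and continuous
   maps; [pull F f] is f^*. *)
Record cofunctor := Cofunctor {
  cofunctor_obj :> topologicalType -> Type;
  pull : forall X Y : topologicalType,
    continuousType X Y -> cofunctor_obj Y -> cofunctor_obj X;
  pull_id : forall X : topologicalType, pull (@idfun X) =1 id;
  pull_comp : forall (X Y Z : topologicalType)
      (g : continuousType Y Z) (f : continuousType X Y),
    pull (g \o f) =1 pull f \o pull g
}.

Arguments pull F {X Y} f : rename.

Definition cohomology_operation (F : cofunctor)
    (theta : forall X : topologicalType, F X -> F X) : Prop :=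
  forall (X Y : topologicalType) (f : continuousType X Y),
    pull F f \o theta Y =1 theta X \o pull F f.

Arguments cohomology_operation F theta : clear implicits.

Record sectioned_map (X Y : topologicalType) := SectionedMap {
  smap :> continuousType X Y;
  ssection : continuousType Y X;
  ssectionP : smap \o ssection =1 id
}.

(* Pullback squares in the category of topological spaces
<<
        g'
    X' ----> X
    |        |
  f'|        |f
    v        v
    Y' ----> Y
        g
>>
   determined up to homeomorphism of X'; see [fiber_productP] for
   X' = X *_Y Y'. *)
Definition fiber_square (X Y X' Y' : topologicalType)
    (f : continuousType X Y) (g : continuousType Y' Y)
    (g' : continuousType X' X) (f' : continuousType X' Y') : Prop :=
  f \o g' =1 g \o f' /\
  forall (T : topologicalType)
      (u : continuousType T X) (v : continuousType T Y'),
    f \o u =1 g \o v ->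
    exists! w : continuousType T X', g' \o w =1 u /\ f' \o w =1 v.

Definition fiber_product (X Y Y' : topologicalType)
    (f : continuousType X Y) (g : continuousType Y' Y) : topologicalType :=
  set_type [set p : X * Y' | f p.1 = g p.2].

Section fiber_product.
Context (X Y Y' : topologicalType).
Context (f : continuousType X Y) (g : continuousType Y' Y).

Definition fiber_fst (p : fiber_product f g) : X := (set_val p).1.
Definition fiber_snd (p : fiber_product f g) : Y' := (set_val p).2.

Lemma fiber_fst_continuous : continuous fiber_fst.
Proof.
move=> p; apply: (@continuous_comp _ _ _ set_val fst).
  exact: initial_continuous.
exact: cvg_fst.
Qed.

Lemma fiber_snd_continuous : continuous fiber_snd.
Proof.
move=> p; apply: (@continuous_comp _ _ _ set_val snd).
  exact: initial_continuous.
exact: cvg_snd.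
Qed.

HB.instance Definition _ := isContinuous.Build _ _ fiber_fst
  fiber_fst_continuous.
HB.instance Definition _ := isContinuous.Build _ _ fiber_snd
  fiber_snd_continuous.

Lemma fiber_productP : fiber_square f g fiber_fst fiber_snd.
Proof.
split=> [[p pP]|T u v uv]; first exact: (set_mem pP).
have mem t : (u t, v t) \in [set p : X * Y' | f p.1 = g p.2].
  by apply/mem_set => /=; exact: uv.
pose w t : fiber_product f g := exist _ (u t, v t) (mem t).
have cw : continuous w.
  apply: continuous_comp_initial => t.
  by apply: cvg_pair => /=; exact: cts_fun.
exists (mkcts cw); split=> [|w' [w1 w2]]; first by split.
apply/continuousEP => t; apply: val_inj => /=.
move: (w1 t) (w2 t); rewrite /fiber_fst /fiber_snd /= => <- <-.
by rewrite -surjective_pairing.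
Qed.

End fiber_product.

Section base_change.
Context (X Y X' Y' : topologicalType) (f : sectioned_map X Y).
Context (g : continuousType Y' Y).
Context (g' : continuousType X' X) (f' : continuousType X' Y').

Lemma induced_section_unique_exists (sq : fiber_square f g g' f') :
  exists! s' : continuousType Y' X',
    f' \o s' =1 id /\ g' \o s' =1 ssection f \o g.
Proof.
have [|w [[w1 w2] wu]] := sq.2 Y' (ssection f \o g) (@idfun Y').
  by move=> y; exact: (ssectionP f (g y)).
by exists w; split=> // w' [w'1 w'2]; apply: wu.
Qed.

Definition induced_section (sq : fiber_square f g g' f') :
    continuousType Y' X' :=
  sval (cid (induced_section_unique_exists sq)).

Lemma induced_sectionK (sq : fiber_square f g g' f') :
  f' \o induced_section sq =1 id.
Proof. exact: (svalP (cid (induced_section_unique_exists sq))).1.1. Qed.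

Lemma induced_section_comp (sq : fiber_square f g g' f') :
  g' \o induced_section sq =1 ssection f \o g.
Proof. exact: (svalP (cid (induced_section_unique_exists sq))).1.2. Qed.

Definition base_change (sq : fiber_square f g g' f') : sectioned_map X' Y' :=
  SectionedMap (induced_sectionK sq).

End base_change.

(* In the compatibility with a fiber square, f' carries the section induced by
   that of f. *)
Definition generalized_cohomology_operation (F : cofunctor)
    (Theta : forall X Y : topologicalType, sectioned_map X Y -> F X -> F Y) :
    Prop :=
  forall (X Y X' Y' : topologicalType) (f : sectioned_map X Y)
      (g : continuousType Y' Y)
      (g' : continuousType X' X) (f' : continuousType X' Y')
      (sq : fiber_square f g g' f'),
    Theta X' Y' (base_change sq) \o pull F g' =1 pull F g \o Theta X Y f.

Arguments generalized_cohomology_operation F Theta : clear implicits.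

Definition section_operation (F : cofunctor)
    (theta : forall X : topologicalType, F X -> F X)
    (X Y : topologicalType) (f : sectioned_map X Y) : F X -> F Y :=
  pull F (ssection f) \o theta X.

Arguments section_operation F theta X Y f : clear implicits.

(* Main.v *)
Require Import Defs.
From mathcomp Require Import all_boot all_classical topology.

(** Naturality of the operation along g' moves it past g'^*, so both sides are
    pullbacks of the same class theta_X(x), one along g' o s' and the other
    along s o g.  These maps agree: that is the defining property of the
    section s' induced by s. *)

Theorem lemma4p7 (F : cofunctor)
    (theta : forall X : topologicalType, F X -> F X)
    (theta_natural : cohomology_operation F theta) :
  generalized_cohomology_operation F (section_operation F theta).
Proof.
move=> X Y X' Y' f g g' f' sq x; rewrite /section_operation /=.
have -> : theta X' (pull F g' x) = pull F g' (theta X x).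
  by rewrite -[RHS]/((pull F g' \o theta X) x) theta_natural.
rewrite -[LHS]/((pull F (induced_section sq) \o pull F g') (theta X x)).
rewrite -[RHS]/((pull F g \o pull F (ssection f)) (theta X x)).
rewrite -!pull_comp; congr (pull F _ _).
(* Pointwise equality of continuous maps is equality of the bundled maps to
   which F applies. *)
by apply/continuousEP; exact: induced_section_comp.
Qed.
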